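(* Let $\mathcal{A}=\{A_1,\dots,A_p\}$ be a finite set of $n\times n$ nonnegative matrices which is positively-irreducible. If, for every integer $d\geq 0$, $\lambda_d$ denotes an eigenvalue of the map $T^d$, then $$\lim_{d\to\infty}\lambda_d=\rho(\mathcal{A}).$$ In particular, the sequence of spectral radii $(r(T^d))_{d\geq 0}$ is non-increasing and its limit is equal to $\rho(\mathcal{A})$.
   Context: $[p]=\{1,\dots,p\}$; $\mathbb{R}_+^n$ is the closed cone of vectors with nonnegative entries; suprema of vectors are taken entrywise. Joint spectral radius: $\rho(\mathcal{A})=\lim_{k\to\infty}\max_{1\leq i_1,\dots,i_k\leq p}\|A_{i_1}\cdots A_{i_k}\|^{1/k}$. The faces of $\mathbb{R}_+^n$ are the sets $\{x\in\mathbb{R}_+^n: x_i=0\text{ if }i\notin I\}$, $I\subseteq\{1,\dots,n\}$; those with $I=\emptyset$ and $I=\{1,\dots,n\}$ are trivial. A set of nonnegative matrices is positively-irreducible if no non-trivial face of $\mathbb{R}_+^n$ is left invariant by all matrices of the set. The operator $T^d$: let $\tau^d:[p]^d\times[p]\to[p]^d$ be $\tau^d(i_1\cdots i_d,a)=i_2\cdots i_d a$ (for $d=0$, $[p]^0$ consists only of the empty word and $\tau^0$ is constant). $T^d$ is the self-map of $\prod_{s\in[p]^d}\mathbb{R}_+^n$ sending $x=(x_s)_s$ to the vector with $s$-component $T^d_s(x)=\sup_{r\in[p]^d,\,a\in[p]:\ \tau^d(r,a)=s}A_a^T x_r$. In particular $T^0(x)=\sup_{1\leq a\leq p}A_a^Tx$.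 An eigenvalue of $T^d$ is a scalar $\lambda$ such that $T^d(u)=\lambda u$ for some nonzero $u\in\prod_{s\in[p]^d}\mathbb{R}_+^n$. Spectral radius of a monotone ($x\leq y\Rightarrow f(x)\leq f(y)$), positively homogeneous ($f(\lambda x)=\lambda f(x)$ for $\lambda>0$) self-map $f$ of a cone $\mathcal{C}$: $r(f)=\lim_{k\to\infty}\|f^k(x)\|^{1/k}$ for $x\in\operatorname{int}\mathcal{C}$ (independent of the choice of $x$ and of the norm). *)

(* Defs.v *)
(* MathComp-Analysis; the scalars are an arbitrary R : realType. *)
From mathcomp Require Export all_boot all_order all_algebra.
From mathcomp Require Export all_classical all_reals all_analysis.
Export Order.TTheory GRing.Theory Num.Theory.
Export numFieldNormedType.Exports.

Set Implicit Arguments.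
Unset Strict Implicit.
Unset Printing Implicit Defensive.

Local Open Scope classical_set_scope.
Local Open Scope ring_scope.

Definition nonneg_mx (R : realType) (m n : nat) : set 'M[R]_(m, n) :=
  [set M | forall i j, 0 <= M i j].

Definition face (R : realType) (n : nat) (I : {set 'I_n}) : set 'cV[R]_n :=
  [set x | nonneg_mx x /\ forall i, i \notin I -> x i 0 = 0].

Definition positively_irreducible (R : realType) (n p : nat)
    (A : 'I_p -> 'M[R]_n) : Prop :=
  forall I : {set 'I_n}, I != finset.set0 -> I != [set: 'I_n]%SET ->
    ~ (forall a x, face I x -> face I (A a *m x)).

(* The norm is the maximum of the moduli of the entries; since all norms on
   'M[R]_n are equivalent, the limit does not depend on this choice. *)
Definition joint_spectral_radius (R : realType) (n p : nat)
    (A : 'I_p -> 'M[R]_n) : R :=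
  lim ((fun k : nat =>
    \big[Num.max/0]_(w : k.-tuple 'I_p)
       (`| \prod_(a <- w) A a | `^ (k%:R)^-1)) @ \oo).

Notation word p d := (d.-tuple 'I_p).

(* (i_1 ... i_d, a) |-> i_2 ... i_d a; for d = 0 it returns the empty word *)
Definition tau (p d : nat) (r : word p d) (a : 'I_p) : word p d :=
  [tuple of behead (rcons r a)].

(* The product of the spaces R^n over the words s of length d, as a matrix
   space so as to use the norm and the topology of matrices: column number
   [enum_rank s] of the matrix x is the component x_s. *)
Notation wordvec R n p d := 'M[R]_(n, #|{: word p d}|).

Definition word_comp (R : realType) (n p d : nat)
    (x : wordvec R n p d) (s : word p d) : 'cV[R]_n :=
  col (enum_rank s) x.

(* All the maxima are over nonempty families when 0 < p, and of nonnegative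
   numbers when the matrices A a and x are nonnegative; starting them at 0 is
   then harmless. *)
Definition Tmap (R : realType) (n p : nat) (A : 'I_p -> 'M[R]_n) (d : nat)
    (x : wordvec R n p d) : wordvec R n p d :=
  \matrix_(i, j) \big[Num.max/0]_(ra : word p d * 'I_p
                                  | tau ra.1 ra.2 == enum_val j)
                   ((A ra.2)^T *m word_comp x ra.1) i 0.

Definition cone_eigenvalue (R : realType) (V : normedModType R) (C : set V)
    (f : V -> V) (lambda : R) : Prop :=
  exists u : V, [/\ C u, u != 0 & f u = lambda *: u].

(* The common value of the limits at all the interior points of C. *)
Definition cone_spectral_radius (R : realType) (V : normedModType R)
    (C : set V) (f : V -> V) : R :=
  get [set r : R | forall x : V, C° x ->
    (fun k : nat => `| iter k f x | `^ (k%:R)^-1) @ \oo --> r].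

(* Main.v *)
(* Let [M k] be the largest norm of a product of [k] matrices of the family and
   let [e] be the all-ones vector. A word of length [d] remembers the last [d]
   matrices applied, so the suprema in [d] successive applications of [T^d] do
   not interact: [(T^d)^d e] is bounded by sums of columns of products of length
   [d], whence [|(T^d)^d e| <= n * M d]. By submultiplicativity both [r (T^d)]
   and every eigenvalue of [T^d] are at most [(n * M d)^(1/d)], which tends to
   the joint spectral radius.
   Conversely the iterates of [T^d] dominate the transposes of all products,
   which gives [M k <= |(T^d)^k e|]. If [T^d u = lambda u], the sum [y] of the
   components of [u] satisfies [A_w^T y <= C lambda^k y] for every word [w] of
   length [k], and [y] is positive by irreducibility, so [M k <= K lambda^k]. *)
Require Import Defs.

Set Implicit Arguments.
Unset Strict Implicit.
Unset Printing Implicit Defensive.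

Local Open Scope classical_set_scope.
Local Open Scope ring_scope.

(** * Asymptotics of [k]-th roots of real sequences *)

Section RootAsymptotics.
Variable R : realType.
Implicit Types (a b : nat -> R) (c K L : R).

Lemma root_exprn c k : (0 < k)%N -> 0 <= c -> (c ^+ k) `^ (k%:R)^-1 = c.
Proof.
move=> k0 c0; rewrite -powR_mulrn// -powRrM divff ?powRr1//.
by rewrite pnatr_eq0 -lt0n.
Qed.

Lemma ler_root (x y : R) k : 0 <= x -> x <= y -> x `^ (k%:R)^-1 <= y `^ (k%:R)^-1.
Proof.
by move=> x0 xy; apply: ge0_ler_powR; rewrite ?invr_ge0 ?nnegrE// (le_trans x0).
Qed.

Lemma root_const_cvg K : 0 < K -> (fun k : nat => K `^ (k%:R)^-1) @ \oo --> (1 : R).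
Proof.
move=> K0; have E (k : nat) : K `^ (k%:R)^-1 = expR ((k%:R)^-1 * ln K).
  by rewrite /powR gt_eqF.
under eq_fun do rewrite E.
suff: (fun k : nat => expR ((k%:R)^-1 * ln K)) @ \oo --> expR (0 * ln K).
  by rewrite mul0r expR0.
apply: continuous_cvg; first exact: continuous_expR.
apply: cvgMr_tmp.
apply/gtr0_cvgV0; last exact: cvgr_idn.
by near=> k; rewrite ltr0n; near: k; exact: nbhs_infty_gt.
Unshelve. all: by end_near. Qed.

Lemma root_scale_cvg b K L : 0 < K -> (forall k, 0 <= b k) ->
  (fun k : nat => b k `^ (k%:R)^-1) @ \oo --> L ->
  (fun k : nat => (K * b k) `^ (k%:R)^-1) @ \oo --> L.
Proof.
move=> K0 b0 bL; under eq_fun do rewrite (powRM _ (ltW K0)) ?b0//.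
by rewrite -[L]mul1r; apply: cvgM bL; exact: root_const_cvg.
Qed.

(** Constant factors disappear under [k]-th roots. This makes growth rates independent of the
    starting vector and of the factor [n] coming from the norm. *)
Lemma root_equiv_cvg a b K1 K2 L : 0 < K1 -> 0 < K2 -> (forall k, 0 <= b k) ->
  (forall k, K1 * b k <= a k <= K2 * b k) ->
  (fun k : nat => b k `^ (k%:R)^-1) @ \oo --> L ->
  (fun k : nat => a k `^ (k%:R)^-1) @ \oo --> L.
Proof.
move=> K10 K20 b0 ab bL.
apply: squeeze_cvgr (root_scale_cvg K10 b0 bL) (root_scale_cvg K20 b0 bL).
apply: nearW => k; have /andP[h1 h2] := ab k.
have h0 : 0 <= K1 * b k by rewrite mulr_ge0// ltW.
by rewrite !ler_root// (le_trans h0).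
Qed.

Lemma ler_lim_root a b K L L' : 0 < K -> (forall k, 0 <= a k) ->
  (forall k, a k <= K * b k) ->
  (fun k : nat => a k `^ (k%:R)^-1) @ \oo --> L ->
  (fun k : nat => b k `^ (k%:R)^-1) @ \oo --> L' -> L <= L'.
Proof.
move=> K0 a0 ab aL bL.
have b0 k : 0 <= b k by rewrite -(pmulr_rge0 _ K0) (le_trans (a0 k)).
apply: ler_cvg_to aL (root_scale_cvg K0 b0 bL) _.
by apply: nearW => k; exact: ler_root.
Qed.

Lemma root_exprn_cvg c : 0 <= c -> (fun k : nat => (c ^+ k) `^ (k%:R)^-1) @ \oo --> c.
Proof.
move=> c0; apply: cvg_near_cst.
by near=> k; rewrite root_exprn//; near: k; exact: nbhs_infty_gt.
Unshelve. all: by end_near. Qed.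

(* Fekete's lemma in multiplicative form; the limit is the infimum. *)
Lemma submultiplicative_root_cvg a : (forall k, 0 <= a k) ->
  (forall k l, a (k + l)%N <= a k * a l) ->
  exists2 L, (fun k : nat => a k `^ (k%:R)^-1) @ \oo --> L &
    forall k, (0 < k)%N -> L <= a k `^ (k%:R)^-1.
Proof.
move=> a0 aM.
pose E := [set a k `^ (k%:R)^-1 | k in [set k | (0 < k)%N]].
have Elb : has_lbound E by exists 0 => _ [k _ <-]; exact: powR_ge0.
have infE k : (0 < k)%N -> inf E <= a k `^ (k%:R)^-1.
  by move=> k0; apply: ge_inf => //; exists k.
have Einf : has_inf E by split=> //; exists (a 1 `^ 1%:R^-1), 1.
exists (inf E) => //.
apply/cvgrPdist_le => /= e e0.
have [_ [m m0 <-] lem] : exists2 x, E x & x < inf E + e / 2.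
  by apply: inf_adherent => //; rewrite divr_gt0.
set c := inf E + e / 2 in lem.
have c0 : 0 < c by apply: le_lt_trans lem; exact: powR_ge0.
have amc : a m <= c ^+ m.
  have <- : (a m `^ (m%:R)^-1) ^+ m = a m.
    rewrite -powR_mulrn ?powR_ge0// -powRrM mulVf ?powRr1//.
    by rewrite pnatr_eq0 -lt0n.
  by rewrite lerXn2r ?nnegrE ?powR_ge0// ltW.
(* For [k = q * m + r], the bound is [c ^+ (q * m) * a r], that is [c ^+ k * (a r / c ^+ r)]. [K]
   dominates all these ratios for [r < m], and its summand [1] keeps it positive. *)
pose K := 1 + \sum_(r < m) a r / c ^+ r.
have K1 : 1 <= K.
  by rewrite lerDl sumr_ge0// => r _; rewrite divr_ge0// exprn_ge0// ltW.
have K0 : 0 < K by exact: lt_le_trans K1.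
have aq q r : a (q * m + r)%N <= c ^+ (q * m) * a r.
  elim: q => [|q ih]; first by rewrite mul0n add0n expr0 mul1r.
  rewrite mulSn -addnA exprD -mulrA; apply: le_trans (aM _ _) _.
  by apply: ler_pM.
have aK k : a k <= K * c ^+ k.
  rewrite [in leLHS](divn_eq k m); apply: le_trans (aq _ _) _.
  rewrite [in leRHS](divn_eq k m) exprD mulrCA ler_pM2l ?exprn_gt0//.
  rewrite -ler_pdivrMr ?exprn_gt0// /K.
  rewrite (bigD1 (Ordinal (ltn_pmod k m0)))//= addrCA lerDl addr_ge0//.
  by rewrite sumr_ge0// => r _; rewrite divr_ge0// exprn_ge0// ltW.
have ub : \forall k \near \oo, (K * c ^+ k) `^ (k%:R)^-1 <= inf E + e.
  have /cvgr_le : (fun k : nat => (K * c ^+ k) `^ (k%:R)^-1) @ \oo --> c.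
    apply: root_scale_cvg => // [k|]; first by rewrite exprn_ge0// ltW.
    by apply: root_exprn_cvg; exact: ltW.
  by apply; rewrite /c ltrD2l ltr_pdivrMr// ltr_pMr// ltr1n.
near=> k; have k0 : (0 < k)%N by near: k; exact: nbhs_infty_gt.
rewrite ler_distlC; apply/andP; split.
  by rewrite (le_trans _ (infE _ k0))// gerBl ltW.
by apply: (le_trans (ler_root k (a0 k) (aK k))); near: k.
Unshelve. all: by end_near. Qed.

End RootAsymptotics.

(** * The entrywise maximum norm and the interior of the nonnegative cone *)

Section MatrixNorm.
Variables (R : realType) (m n : nat).
Implicit Types (x y : 'M[R]_(m, n)) (c : R).

Lemma ler_mxnorm x c : 0 <= c -> (forall i j, `|x i j| <= c) -> `|x| <= c.
Proof.
by move=> c0 h; rewrite [leLHS]/Num.Def.normr/= mx_normrE bigmax_le.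
Qed.

Lemma mxnorm_ge x i j : `|x i j| <= `|x|.
Proof.
rewrite [leRHS]/Num.Def.normr/= mx_normrE.
exact: (le_bigmax _ (fun ij : 'I_m * 'I_n => `|x ij.1 ij.2|) (i, j)).
Qed.

Lemma ler_mxnorm_nonneg x y : nonneg_mx x -> (forall i j, x i j <= y i j) ->
  `|x| <= `|y|.
Proof.
move=> x0 xy; apply: ler_mxnorm => // i j.
by rewrite ger0_norm// (le_trans (xy i j))// (le_trans (ler_norm _))// mxnorm_ge.
Qed.

Lemma interior_nonneg_mx_gt0 x : (@nonneg_mx R m n)° x -> forall i j, 0 < x i j.
Proof.
rewrite /interior /= => /nbhs_normP[e /= e0 xe] i j.
have e20 : 0 < e / 2 by rewrite divr_gt0.
(* Lowering every entry by [e / 2] stays in the ball, hence in the cone, so each entry of [x] is at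
   least [e / 2]. *)
have /xe /(_ i j) : ball_ [eta Num.Def.normr] x e (x - const_mx (e / 2)).
  rewrite /= opprB addrC subrK; apply: (@le_lt_trans _ _ (e / 2)).
    by apply: ler_mxnorm => [|k l]; rewrite ?mxE ?ger0_norm// ltW.
  by rewrite ltr_pdivrMr// ltr_pMr// ltr1n.
by rewrite !mxE subr_ge0; exact: lt_le_trans.
Qed.

Lemma interior_nonneg_mx_const1 : (@nonneg_mx R m n)° (const_mx 1).
Proof.
rewrite /interior /=; apply/nbhs_ballP; exists 1 => //= y.
rewrite -ball_normE /= => y1 i j.
have := le_lt_trans (mxnorm_ge _ i j) y1.
by rewrite !mxE => /(le_lt_trans (ler_norm _)); rewrite ltrBlDr ltrDl => /ltW.
Qed.

End MatrixNorm.

(** * Iterates of [T^d] and paths of words *)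

Section WordOperator.
Variables (R : realType) (n p : nat) (A : 'I_p -> 'M[R]_n).
Hypothesis A_ge0 : forall a, nonneg_mx (A a).

Local Notation T d := (@Tmap R n p A d).
Local Notation prodw w := (\prod_(a <- w) A a).
Local Notation e d := (const_mx 1 : wordvec R n p d).

Lemma prodw_ge0 (w : seq 'I_p) : nonneg_mx (prodw w).
Proof.
elim: w => [|a w ih] i j; first by rewrite big_nil mxE ler0n.
by rewrite big_cons -mulmxE mxE sumr_ge0// => k _; rewrite mulr_ge0// A_ge0.
Qed.

Section FixedDepth.
Variable d : nat.
Implicit Types (x y : wordvec R n p d) (r s : word p d) (a : 'I_p) (c : R).

Lemma TmapE x i j : T d x i j =
  \big[Num.max/0]_(ra : word p d * 'I_p | tau ra.1 ra.2 == enum_val j)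
    \sum_k A ra.2 k i * x k (enum_rank ra.1).
Proof.
rewrite mxE; apply: eq_bigr => ra _; rewrite mxE.
by apply: eq_bigr => k _; rewrite !mxE.
Qed.

Lemma Tmap_le x i s c : 0 <= c ->
  (forall r a, tau r a = s -> \sum_k A a k i * x k (enum_rank r) <= c) ->
  T d x i (enum_rank s) <= c.
Proof.
move=> c0 h; rewrite TmapE bigmax_le// => -[r a] /= /eqP.
by rewrite enum_rankK; exact: h.
Qed.

Lemma le_Tmap x i r a :
  \sum_k A a k i * x k (enum_rank r) <= T d x i (enum_rank (tau r a)).
Proof.
rewrite TmapE.
apply: (le_bigmax_cond (j := (r, a)) _
  (fun ra => \sum_k A ra.2 k i * x k (enum_rank ra.1))).
by rewrite enum_rankK.
Qed.

Lemma Tmap_ge0 x : nonneg_mx (T d x).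
Proof. by move=> i j; rewrite TmapE bigmax_ge_id. Qed.

Lemma Tmap_mono x y : (forall i j, x i j <= y i j) ->
  forall i j, T d x i j <= T d y i j.
Proof.
move=> xy i j; rewrite !TmapE; apply: le_bigmax2 => ra _.
by apply: ler_sum => k _; rewrite ler_wpM2l// A_ge0.
Qed.

Lemma TmapZ c x : 0 <= c -> T d (c *: x) = c *: T d x.
Proof.
move=> c0; apply/matrixP => i j; rewrite [RHS]mxE !TmapE.
rewrite (big_morph ( *%R c) (id1 := 0) (op1 := Num.max)) ?mulr0//; last first.
  by move=> u v; rewrite maxr_pMr.
apply: eq_bigr => ra _; rewrite mulr_sumr; apply: eq_bigr => k _.
by rewrite mxE mulrCA.
Qed.

Lemma iter_Tmap_ge0 k x : nonneg_mx x -> nonneg_mx (iter k (T d) x).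
Proof. by case: k => // k _; rewrite iterS; exact: Tmap_ge0. Qed.

Lemma iter_Tmap_mono k x y : (forall i j, x i j <= y i j) ->
  forall i j, iter k (T d) x i j <= iter k (T d) y i j.
Proof. by move=> xy; elim: k => // k ih; rewrite !iterS; exact: Tmap_mono. Qed.

Lemma iter_TmapZ k c x : 0 <= c -> iter k (T d) (c *: x) = c *: iter k (T d) x.
Proof. by move=> c0; elim: k => // k ih; rewrite !iterS ih TmapZ. Qed.

Lemma nonneg_const1 : nonneg_mx (e d).
Proof. by move=> i j; rewrite mxE. Qed.

(** [x] lies below [|x|] times the all-ones vector, and [T^d] is monotone and homogeneous. *)
Lemma norm_iter_Tmap_le k x : nonneg_mx x ->
  `|iter k (T d) x| <= `|x| * `|iter k (T d) (e d)|.
Proof.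
move=> x0; rewrite -[X in X * _]normr_id -normrZ -iter_TmapZ//.
apply: ler_mxnorm_nonneg; first exact: iter_Tmap_ge0.
apply: iter_Tmap_mono => i j; rewrite !mxE mulr1.
by rewrite (le_trans (ler_norm _))// mxnorm_ge.
Qed.

Lemma le_norm_iter_Tmap k c x : 0 <= c -> (forall i j, c <= x i j) ->
  c * `|iter k (T d) (e d)| <= `|iter k (T d) x|.
Proof.
move=> c0 cx; rewrite -{1}(ger0_norm c0) -normrZ -iter_TmapZ//.
apply: ler_mxnorm_nonneg.
  by apply: iter_Tmap_ge0 => i j; rewrite !mxE mulr1.
by apply: iter_Tmap_mono => i j; rewrite !mxE mulr1.
Qed.

Lemma norm_iter_Tmap_submultiplicative k l :
  `|iter (k + l) (T d) (e d)| <= `|iter k (T d) (e d)| * `|iter l (T d) (e d)|.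
Proof.
rewrite iterD mulrC; apply: norm_iter_Tmap_le.
by apply: iter_Tmap_ge0; exact: nonneg_const1.
Qed.

(** Fekete's lemma at the all-ones vector gives a limit that is also a lower bound. Every interior
    [x] lies between two positive multiples of that vector, so the [get] of the definition selects
    this limit. *)
Lemma cone_spectral_radius_cvg :
  let r := cone_spectral_radius (@nonneg_mx R n #|{: word p d}|) (T d) in
  (fun k : nat => `|iter k (T d) (e d)| `^ (k%:R)^-1) @ \oo --> r /\
  forall k, (0 < k)%N -> r <= `|iter k (T d) (e d)| `^ (k%:R)^-1.
Proof.
have [L LT leL] := submultiplicative_root_cvg (fun=> normr_ge0 _)
  norm_iter_Tmap_submultiplicative.
suff -> : cone_spectral_radius (@nonneg_mx R n #|{: word p d}|) (T d) = L by [].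
apply: get_unique => [x /interior_nonneg_mx_gt0 x0|L' L'T]; last first.
  exact: cvg_unique (L'T _ (interior_nonneg_mx_const1 _ _ _)) LT.
(* The least entry of [x], capped at [1]: the starting value must be positive for [c] to be. *)
pose c := \big[Num.min/1]_(ij : 'I_n * 'I_#|{: word p d}|) x ij.1 ij.2.
have c0 : 0 < c.
  by rewrite /c; elim/big_ind: _ => // u v u0 v0; rewrite lt_min u0 v0.
apply: (root_equiv_cvg (K1 := c) (K2 := `|x| + 1)) LT => // k.
apply/andP; split.
  apply: le_norm_iter_Tmap => [|i j]; first exact: ltW.
  exact: (bigmin_le _ (i, j) (fun ij => x ij.1 ij.2)).
apply: (le_trans (norm_iter_Tmap_le k _)) => [i j|]; first exact: ltW.
by rewrite ler_wpM2r// lerDl.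
Qed.

(** Reading [w] from the word [r] follows one path of [tau], ending at [s], and each supremum
    dominates the term of that path. [s] must not depend on [i], since the induction step sums over
    coordinates. *)
Lemma prodw_le_iter_Tmap x w r : exists s, forall i,
  \sum_k prodw w k i * x k (enum_rank r)
    <= iter (size w) (T d) x i (enum_rank s).
Proof.
elim/last_ind: w => [|w a [s ih]].
  exists r => i; rewrite big_nil (bigD1 i)//= mxE eqxx mul1r big1 ?addr0// => k ki.
  by rewrite mxE (negbTE ki) mul0r.
exists (tau s a) => i; rewrite size_rcons iterS.
apply: le_trans (le_Tmap _ _ _ _).
rewrite big_rcons /=.
under eq_bigr do rewrite -mulmxE mxE mulr_suml.
rewrite exchange_big /=; apply: ler_sum => j _.
apply: le_trans (ler_wpM2l (A_ge0 a j i) (ih j)).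
rewrite mulr_sumr; apply: ler_sum => k _.
by rewrite -mulrA mulrCA.
Qed.

(** Every path of [k <= d] steps ending at [s] reads the last [k] letters of [s]. The suprema then
    range only over forgotten letters, on which the all-ones vector does not depend. *)
Lemma iter_Tmap_le_prodw k s i : (k <= d)%N ->
  iter k (T d) (e d) i (enum_rank s) <= \sum_j prodw (drop (d - k) s) j i.
Proof.
elim: k s i => [|k ih] s i kd.
  rewrite subn0 drop_oversize ?size_tuple// big_nil mxE.
  by rewrite (bigD1 i)//= mxE eqxx lerDl sumr_ge0// => j _; rewrite mxE ler0n.
rewrite iterS; apply: Tmap_le => [|r a rs].
  by rewrite sumr_ge0// => j _; exact: prodw_ge0.
(* [tau] drops the oldest letter of [r], which turns the offset [d - k.+1] in [s] into [d - k] in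
   [r]. *)
have -> : drop (d - k.+1) s = rcons (drop (d - k) r) a.
  rewrite -rs /= -drop1 drop_drop addn1 subnSK// drop_rcons//.
  by rewrite size_tuple leq_subr.
rewrite big_rcons /=.
under [leRHS]eq_bigr do rewrite -mulmxE mxE.
rewrite exchange_big /=; apply: ler_sum => j _.
rewrite -mulr_suml mulrC ler_wpM2r ?A_ge0//.
by apply: ih; exact: ltnW.
Qed.

End FixedDepth.

(** * Growth of the norms of products *)

Definition max_norm_prodw (k : nat) : R :=
  \big[Num.max/0]_(w : k.-tuple 'I_p) `|prodw w|.

Lemma max_norm_prodw_ge0 k : 0 <= max_norm_prodw k.
Proof. exact: bigmax_ge_id. Qed.

Lemma norm_prodw_le w : `|prodw w| <= max_norm_prodw (size w).
Proof.
exact: (le_bigmax _ (fun w : (size _).-tuple 'I_p => `|prodw w|) (in_tuple w)).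
Qed.

(** The entrywise maximum norm of a product of two matrices is bounded by the product of their norms
    only up to a factor [n], which the scaling by [n%:R] absorbs. *)
Lemma max_norm_prodw_submultiplicative k l :
  n%:R * max_norm_prodw (k + l) <=
  (n%:R * max_norm_prodw k) * (n%:R * max_norm_prodw l).
Proof.
rewrite -mulrA ler_wpM2l// bigmax_le// => [|w _].
  by rewrite !mulr_ge0// max_norm_prodw_ge0.
have wk : size (take k w) = k by rewrite size_takel// size_tuple leq_addr.
have wl : size (drop k w) = l by rewrite size_drop size_tuple addKn.
rewrite -(cat_take_drop k w) big_cat /=.
apply: ler_mxnorm => [|i j]; first by rewrite !mulr_ge0// max_norm_prodw_ge0.
rewrite -mulmxE mxE (le_trans (ler_norm_sum _ _ _))//.
apply: (@le_trans _ _ (\sum_(h < n) max_norm_prodw k * max_norm_prodw l)).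
  apply: ler_sum => h _; rewrite normrM ler_pM//.
    by rewrite (le_trans (mxnorm_ge _ _ _))// -[in leRHS]wk norm_prodw_le.
  by rewrite (le_trans (mxnorm_ge _ _ _))// -[in leRHS]wl norm_prodw_le.
by rewrite sumr_const card_ord -[leLHS]mulr_natl mulrCA.
Qed.

Lemma max_root_norm_prodw k : (0 < k)%N ->
  \big[Num.max/0]_(w : k.-tuple 'I_p) (`|prodw w| `^ (k%:R)^-1) =
  max_norm_prodw k `^ (k%:R)^-1.
Proof.
move=> k0; have k1 : (k%:R : R)^-1 != 0 by rewrite invr_eq0 pnatr_eq0 -lt0n.
apply/eqP; rewrite eq_le; apply/andP; split.
  rewrite bigmax_le ?powR_ge0// => w _; apply: ler_root => //.
  by rewrite -[in leRHS](size_tuple w) norm_prodw_le.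
rewrite /max_norm_prodw.
(* The root must fix the default value [0] of the maximum; [0 < k] enters here. *)
elim/big_ind: _ => [|x y xle yle|w _]; first by rewrite powR0// bigmax_ge_id.
  by case: (leP x y).
exact: (le_bigmax _ (fun w : k.-tuple 'I_p => `|prodw w| `^ (k%:R)^-1) w).
Qed.

(** Shows that the [lim] in the definition is a genuine limit: Fekete's lemma applies to
    [n%:R * max_norm_prodw k], and the factor is then removed. *)
Lemma joint_spectral_radius_cvg : (0 < n)%N ->
  (fun k : nat => max_norm_prodw k `^ (k%:R)^-1) @ \oo
    --> joint_spectral_radius A.
Proof.
move=> n0; have n0' : (0 : R) < n%:R by rewrite ltr0n.
have M0 k : 0 <= n%:R * max_norm_prodw k by rewrite mulr_ge0// max_norm_prodw_ge0.
have [L nML _] := submultiplicative_root_cvg M0 max_norm_prodw_submultiplicative.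
have ML : (fun k : nat => max_norm_prodw k `^ (k%:R)^-1) @ \oo --> L.
  apply: (root_equiv_cvg (K1 := n%:R^-1) (K2 := n%:R^-1)) nML; rewrite ?invr_gt0//.
  by move=> k; rewrite mulKf ?lexx// gt_eqF.
suff -> : joint_spectral_radius A = L by [].
rewrite /joint_spectral_radius; apply: cvg_lim => //; apply: cvg_trans ML; apply: near_eq_cvg.
by near=> k; rewrite max_root_norm_prodw//; near: k; exact: nbhs_infty_gt.
Unshelve. all: by end_near. Qed.

(** * Comparison of [r (T^d)] with the joint spectral radius *)

Section SpectralBounds.
Hypotheses (n_gt0 : (0 < n)%N) (p_gt0 : (0 < p)%N).

Local Notation rho := (joint_spectral_radius A).
Local Notation r d :=
  (cone_spectral_radius (@nonneg_mx R n #|{: word p d}|) (T d)).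

Lemma norm_iter_Tmap_le_max_norm_prodw d :
  `|iter d (T d) (e d)| <= n%:R * max_norm_prodw d.
Proof.
apply: ler_mxnorm => [|i j]; first by rewrite mulr_ge0// max_norm_prodw_ge0.
rewrite ger0_norm; last by apply: iter_Tmap_ge0; exact: nonneg_const1.
rewrite -[j]enum_valK (le_trans (iter_Tmap_le_prodw _ _ (leqnn d)))//.
rewrite subnn drop0.
apply: (@le_trans _ _ (\sum_(h < n) max_norm_prodw d)).
  apply: ler_sum => h _; rewrite (le_trans (ler_norm _))//.
  rewrite (le_trans (mxnorm_ge _ _ _))//.
  by rewrite -[in leRHS](size_tuple (enum_val j)) norm_prodw_le.
by rewrite sumr_const card_ord mulr_natl.
Qed.

Lemma max_norm_prodw_le_norm_iter_Tmap d k :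
  max_norm_prodw k <= `|iter k (T d) (e d)|.
Proof.
rewrite bigmax_le// => w _; apply: ler_mxnorm => // h i.
(* Any starting word would do; [0 < p] provides a constant one. *)
have [s /(_ i)] := prodw_le_iter_Tmap (e d) w [tuple of nseq d (Ordinal p_gt0)].
rewrite (size_tuple w) => ws.
rewrite ger0_norm ?prodw_ge0// (le_trans _ (mxnorm_ge _ i (enum_rank s)))//.
rewrite (le_trans _ (ler_norm _))// (le_trans _ ws)//.
rewrite (bigD1 h)//= mxE mulr1 lerDl sumr_ge0// => h' _.
by rewrite mxE mulr1 prodw_ge0.
Qed.

Lemma joint_spectral_radius_le d : rho <= r d.
Proof.
have [rT _] := cone_spectral_radius_cvg d.
apply: (ler_lim_root ltr01 max_norm_prodw_ge0 _ (joint_spectral_radius_cvg n_gt0) rT).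
by move=> k; rewrite mul1r max_norm_prodw_le_norm_iter_Tmap.
Qed.

(** The radius is below the root at every single exponent. The choice [k = d] is one for which the
    iterate is controlled by products. *)
Lemma cone_spectral_radius_le d : (0 < d)%N ->
  r d <= (n%:R * max_norm_prodw d) `^ (d%:R)^-1.
Proof.
have [_ rT] := cone_spectral_radius_cvg d.
move=> d0; apply: le_trans (rT d d0) _; apply: ler_root => //.
exact: norm_iter_Tmap_le_max_norm_prodw.
Qed.

(* The lift x_s |-> x_(i_2 ... i_(d+1)), s = i_1 ... i_(d+1), intertwines T^d
   and T^(d+1) up to an inequality. *)
Lemma iter_TmapS_le d k i (s : word p d.+1) :
  iter k (T d.+1) (e d.+1) i (enum_rank s) <=
  iter k (T d) (e d) i (enum_rank ([tuple of behead s] : word p d)).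
Proof.
elim: k i s => [|k ih] i s; first by rewrite !mxE.
rewrite !iterS; apply: Tmap_le => [|t a ts]; first exact: Tmap_ge0.
have -> : [tuple of behead s] = tau ([tuple of behead t] : word p d) a.
  by apply/val_inj; rewrite /= -ts /=; case: t {ts} => -[].
apply: le_trans (le_Tmap _ _ _ _).
by apply: ler_sum => h _; rewrite ler_wpM2l ?A_ge0// ih.
Qed.

Lemma cone_spectral_radius_nonincreasing : nonincreasing_seq (fun d => r d).
Proof.
apply/nonincreasing_seqP => d.
have [rT _] := cone_spectral_radius_cvg d.
have [rT' _] := cone_spectral_radius_cvg d.+1.
apply: (ler_lim_root ltr01 _ _ rT' rT) => k; first exact: normr_ge0.
rewrite mul1r; apply: ler_mxnorm => // i j.
rewrite ger0_norm; last by apply: iter_Tmap_ge0; exact: nonneg_const1.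
rewrite -[j]enum_valK (le_trans (iter_TmapS_le _ _ _))//.
by rewrite (le_trans (ler_norm _))// mxnorm_ge.
Qed.

(** * Bounds on the eigenvalues of [T^d] *)

Section Eigenvector.
Hypothesis A_irr : positively_irreducible A.
Variables (d : nat) (lambda : R) (u : wordvec R n p d).
Hypotheses (u_ge0 : nonneg_mx u) (u_neq0 : u != 0) (Tu : T d u = lambda *: u).

Let y (i : 'I_n) : R := \sum_(t : word p d) u i (enum_rank t).
Let N : R := #|{: word p d}|%:R.

Lemma eigenvector_gt0 : exists i t, 0 < u i (enum_rank t).
Proof.
apply: contrapT => h; move/eqP: u_neq0; apply; apply/matrixP => i j.
rewrite mxE; apply/eqP; rewrite eq_le u_ge0 andbT leNgt; apply/negP => uij.
by apply: h; exists i, (enum_val j); rewrite enum_valK.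
Qed.

Lemma eigenvalue_ge0 : 0 <= lambda.
Proof.
have [i [t ut]] := eigenvector_gt0.
by rewrite -(pmulr_lge0 _ ut); move: (Tmap_ge0 u i (enum_rank t)); rewrite Tu mxE.
Qed.

Lemma iter_Tmap_eigenvector k : iter k (T d) u = lambda ^+ k *: u.
Proof.
elim: k => [|k ih]; first by rewrite scale1r.
by rewrite iterS ih TmapZ ?exprn_ge0 ?eigenvalue_ge0// Tu scalerA exprSr.
Qed.

Lemma eigenvalue_exp_le : lambda ^+ d <= `|iter d (T d) (e d)|.
Proof.
have u0 : 0 < `|u| by rewrite normr_gt0.
rewrite -(ler_pM2l u0); apply: le_trans (norm_iter_Tmap_le d u_ge0).
rewrite iter_Tmap_eigenvector normrZ mulrC ger0_norm//.
by rewrite exprn_ge0// eigenvalue_ge0.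
Qed.

Lemma eigenvector_sum_ge0 i : 0 <= y i.
Proof. by rewrite sumr_ge0. Qed.

Lemma eigenvector_le_sum i t : u i (enum_rank t) <= y i.
Proof. by rewrite /y (bigD1 t)//= lerDl sumr_ge0. Qed.

(** The end [s] of the path starting at [t] varies with [t]; bounding the component [u_s] by the sum
    [y] removes this dependence. Summing over the starting words costs the factor [N]. *)
Lemma prodw_eigenvector_sum_le w i :
  \sum_k prodw w k i * y k <= N * (lambda ^+ size w * y i).
Proof.
rewrite (eq_bigr (fun k => \sum_t prodw w k i * u k (enum_rank t))) => [|k _];
  last by rewrite mulr_sumr.
rewrite exchange_big /= /N mulr_natl -sumr_const; apply: ler_sum => t _.
have [s /(_ i) /le_trans] := prodw_le_iter_Tmap u w t; apply.
rewrite iter_Tmap_eigenvector mxE ler_wpM2l ?exprn_ge0 ?eigenvalue_ge0//.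
exact: eigenvector_le_sum.
Qed.

(* The vanishing set of y is an invariant face of A, because its complement
   spans an invariant face of the transposed matrices. *)
Lemma eigenvector_sum_gt0 i : 0 < y i.
Proof.
pose I : {set 'I_n} := [set j | y j == 0]%SET.
have IT : I != [set: 'I_n]%SET.
  have [j [t ut]] := eigenvector_gt0.
  apply/eqP => /setP /(_ j); rewrite !inE => /eqP yj.
  by have := lt_le_trans ut (eigenvector_le_sum j t); rewrite yj ltxx.
have I0 : I = finset.set0.
  apply/eqP/negPn/negP => /A_irr /(_ IT); apply => a x [x0 xI].
  split=> [h l|h]; first by rewrite mxE sumr_ge0// => k _; rewrite mulr_ge0// A_ge0.
  rewrite inE mxE => yh; apply: big1 => j _.
  have [yj|yj] := eqVneq (y j) 0; last by rewrite xI ?mulr0// inE.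
  suff /eqP -> : A a h j == 0 by rewrite mul0r.
  (* For a one-letter word and [y j = 0], the bound makes a sum of nonnegative terms at most [0], so
     [A a h j] vanishes as soon as [y h > 0]. *)
  have := prodw_eigenvector_sum_le [:: a] j.
  rewrite yj !mulr0 big_seq1 (bigD1 h)//= => Ay.
  have {}Ay : A a h j * y h <= 0.
    apply: le_trans Ay; rewrite lerDl sumr_ge0// => k _.
    by rewrite mulr_ge0 ?A_ge0 ?eigenvector_sum_ge0.
  rewrite eq_le A_ge0 andbT -(pmulr_lle0 _ (_ : 0 < y h)) //.
  by rewrite lt_neqAle eq_sym yh eigenvector_sum_ge0.
have : i \notin I by rewrite I0 inE.
by rewrite inE => yi; rewrite lt_neqAle eq_sym yi eigenvector_sum_ge0.
Qed.

Lemma joint_spectral_radius_le_eigenvalue : rho <= lambda.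
Proof.
(* The entry [(h, i)] of a product of length [k] is at most [N * (y i / y h) * lambda ^+ k]. The two
   sums bound [y i] and [(y h)^-1] uniformly, and the summand [1] ensures [0 < K]. *)
pose K : R := 1 + N * (\sum_i y i) * (\sum_i (y i)^-1).
have y0 := eigenvector_sum_ge0.
have K0 : 0 < K.
  rewrite ltr_wpDr// !mulr_ge0//; first exact: sumr_ge0.
  by apply: sumr_ge0 => i _; rewrite invr_ge0.
apply: (ler_lim_root K0 max_norm_prodw_ge0 _ (joint_spectral_radius_cvg n_gt0)
  (root_exprn_cvg eigenvalue_ge0)) => k.
have lk0 : 0 <= lambda ^+ k by rewrite exprn_ge0// eigenvalue_ge0.
rewrite bigmax_le ?mulr_ge0// ?(ltW K0)// => w _; apply: ler_mxnorm => [|h i].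
  by rewrite mulr_ge0// ltW.
rewrite ger0_norm ?prodw_ge0//.
have Pw : prodw w h i * y h <= N * (lambda ^+ k * y i).
  have := prodw_eigenvector_sum_le w i; rewrite size_tuple; apply: le_trans.
  by rewrite (bigD1 h)//= lerDl sumr_ge0// => j _; rewrite mulr_ge0// prodw_ge0.
rewrite -(ler_pdivlMr _ _ (eigenvector_sum_gt0 h)) in Pw.
apply: (le_trans Pw).
rewrite mulrDl mul1r; apply: (@le_trans _ _
  (N * (\sum_i y i) * (\sum_i (y i)^-1) * lambda ^+ k)); last by rewrite lerDr.
have -> : N * (lambda ^+ k * y i) / y h = N * (y i / y h) * lambda ^+ k.
  by rewrite -!mulrA (mulrC _ (lambda ^+ k)) (mulrCA (y i)).
rewrite ler_wpM2r// -[leRHS]mulrA ler_wpM2l//; apply: ler_pM => //.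
- by rewrite invr_ge0.
- by rewrite (bigD1 i)//= lerDl sumr_ge0.
- by rewrite (bigD1 h)//= lerDl sumr_ge0// => j _; rewrite invr_ge0.
Qed.

End Eigenvector.
End SpectralBounds.
End WordOperator.

(** * Squeeze of eigenvalues and spectral radii *)

Theorem corollary8 (R : realType) (n p : nat) (hn : (0 < n)%N) (hp : (0 < p)%N)
    (A : 'I_p -> 'M[R]_n)
    (hA : forall a, nonneg_mx (A a))
    (irrA : positively_irreducible A) :
  (forall lambda : nat -> R,
     (forall d, cone_eigenvalue (@nonneg_mx R n #|{: word p d}|)
                  (Tmap A (d := d)) (lambda d)) ->
     lambda @ \oo --> joint_spectral_radius A) /\
  (let r (d : nat) : R :=
     cone_spectral_radius (@nonneg_mx R n #|{: word p d}|) (Tmap A (d := d)) in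
   nonincreasing_seq r /\ r @ \oo --> joint_spectral_radius A).
Proof.
(* The upper bound shared by the eigenvalues and the spectral radii. *)
have nM : (fun d : nat => (n%:R * max_norm_prodw A d) `^ (d%:R)^-1) @ \oo
    --> joint_spectral_radius A.
  apply: root_scale_cvg; first by rewrite ltr0n.
    exact: max_norm_prodw_ge0.
  exact: joint_spectral_radius_cvg.
split=> [lambda lambdaP|r].
  apply: squeeze_cvgr (cvg_cst _) nM.
  near=> d; have [u [u0 uN0 Tu]] := lambdaP d.
  rewrite (joint_spectral_radius_le_eigenvalue hA hn irrA u0 uN0 Tu)//=.
  have d0 : (0 < d)%N by near: d; exact: nbhs_infty_gt.
  have l0 := eigenvalue_ge0 u0 uN0 Tu.
  rewrite -[leLHS](root_exprn d0 l0); apply: ler_root; first by rewrite exprn_ge0.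
  apply: le_trans (eigenvalue_exp_le hA u0 uN0 Tu) _.
  exact: norm_iter_Tmap_le_max_norm_prodw.
split; first exact: cone_spectral_radius_nonincreasing.
apply: squeeze_cvgr (cvg_cst _) nM.
near=> d; rewrite joint_spectral_radius_le//= cone_spectral_radius_le//.
by near: d; exact: nbhs_infty_gt.
Unshelve. all: by end_near. Qed.
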